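(* Let $q\colon\mathbb C\to\mathbb C$ be a polynomial with $\deg q\ge2$ that is hyperbolic and has no attracting periodic points on the unit circle $S_0$, and let $f_n(z)=z^n+q(z)$. Then, under the Hausdorff metric, \[\lim_{n\to\infty}K(f_n)=K_\infty.\]
   Context: The filled Julia set $K(f)$ of $f\colon\mathbb C\to\mathbb C$ is the set of points of $\mathbb C$ whose orbit under iteration of $f$ is bounded. $q^k$ denotes the $k$-th iterate of $q$ ($q^0$ is the identity). Define $K_q=\{z\in\mathbb C: |q^k(z)|<1\text{ for all }k\ge 0\}$ and, for each integer $j\ge 0$, $S_j=\{z\in\mathbb C: |q^j(z)|=1\text{ and }|q^i(z)|<1\text{ for all }0\le i<j\}$; in particular $S_0=\{z\in\mathbb C:|z|=1\}$. Define $K_\infty=K_q\cup\bigcup_{j\ge0}S_j$. A rational map of the Riemann sphere $\hat{\mathbb C}$ (here $q$, with $q(\infty)=\infty$) is called hyperbolic if the orbit of every point of its Fatou set converges to an attracting periodic cycle (for a polynomial of degree at least 2, $\infty$ counts as an attracting fixed point). A periodic point $z_0\in\mathbb C$ of period $k$ is attracting if $|(q^k)'(z_0)|<1$. For compact sets $A_n,A\subset\mathbb C$, $\lim_{n\to\infty}A_n=A$ in the Hausdorff metric means $d_{\mathcal H}(A_n,A)\to0$, where $d_{\mathcal H}(A,B)=\max\{\sup_{a\in A}\inf_{b\in B}|a-b|,\ \sup_{b\in B}\inf_{a\in A}|a-b|\}$. *)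

(* Defs.v *)
From HB Require Import structures.
From mathcomp Require Import all_boot all_order all_algebra.
From mathcomp Require Import complex.
From mathcomp Require Import all_classical all_reals all_analysis.
Set Implicit Arguments.
Unset Strict Implicit.
Unset Printing Implicit Defensive.
Import Order.TTheory GRing.Theory Num.Theory.
Import numFieldNormedType.Exports.
Local Open Scope classical_set_scope.
Local Open Scope complex_scope.
Local Open Scope ring_scope.

Export Normc (normc).

(* R[i] has its field structure from real-closed; this adds the topology and
   the R[i]-normed module structure induced by the modulus. *)
HB.instance Definition _ (R : realType) := NormedModule.copy R[i] (R[i] : numFieldType)^o.

Section RiemannSphere.
Variable R : realType.
Local Notation C := R[i].

(* [Some z] is the finite point z and [None] is the point at infinity. *)
Local Notation sphere := (one_point_compactification C).

(* This metric induces the topology of the one-point compactification. *)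
Definition chordal_dist (x y : sphere) : R :=
  match x, y with
  | Some z, Some w =>
      2 * normc (z - w) /
        (Num.sqrt (1 + normc z ^+ 2) * Num.sqrt (1 + normc w ^+ 2))
  | Some z, None | None, Some z => 2 / Num.sqrt (1 + normc z ^+ 2)
  | None, None => 0
  end.

Definition normal_on (U : set sphere) (F : set (sphere -> sphere)) : Prop :=
  forall s : nat -> sphere -> sphere, (forall j, F (s j)) ->
  exists (phi : nat -> nat) (g : sphere -> sphere),
    {homo phi : i j / (i < j)%N} /\
    forall p, U p -> exists2 N, nbhs p N &
      forall e : R, 0 < e ->
        \forall j \near \oo, forall x, N x ->
          chordal_dist (s (phi j) x) (g x) < e.

Definition fatou_set (f : sphere -> sphere) : set sphere :=
  [set p | exists U : set sphere,
    [/\ open U, U p & normal_on U [set iter k f | k in [set: nat]]]].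

Definition sphere_map (q : {poly C}) (p : sphere) : sphere :=
  if p is Some z then Some q.[z] else None.

(* The period k need not be minimal: if p is the minimal period of z then
   (q^k)'(z) is the (k/p)-th power of (q^p)'(z), so the condition on the
   multiplier does not depend on the choice of k. *)
Definition attracting_periodic (q : {poly C}) (k : nat) (z : C) : Prop :=
  [/\ (0 < k)%N, iter k (horner q) z = z &
      normc (derive1 (iter k (horner q)) z) < 1].

(* The second disjunct is the superattracting fixed point at infinity of a
   polynomial of degree at least 2. *)
Definition attracting_cycle (q : {poly C}) (A : set sphere) : Prop :=
  (exists (k : nat) (z : C), attracting_periodic q k z /\
     A = [set (Some (iter i (horner q) z) : sphere) | i in [set: nat]])
  \/ ((2 < size q)%N /\ A = [set (None : sphere)]).

Definition converges_to_set (u : nat -> sphere) (A : set sphere) : Prop :=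
  forall e : R, 0 < e ->
    \forall k \near \oo, exists2 a, A a & chordal_dist (u k) a < e.

Definition hyperbolic (q : {poly C}) : Prop :=
  forall p, fatou_set (sphere_map q) p ->
    exists A, attracting_cycle q A /\
      converges_to_set (fun k => iter k (sphere_map q) p) A.

End RiemannSphere.

Section LimitSet.
Variable R : realType.
Local Notation C := R[i].

Definition filled_julia (f : C -> C) : set C :=
  [set z | exists M : R, forall k, normc (iter k f z) <= M].

Definition K_ (q : {poly C}) : set C :=
  [set z | forall k, normc (iter k (horner q) z) < 1].

Definition S_ (q : {poly C}) (j : nat) : set C :=
  [set z | normc (iter j (horner q) z) = 1 /\
           forall i, (i < j)%N -> normc (iter i (horner q) z) < 1].

Definition K_infty (q : {poly C}) : set C :=
  K_ q `|` \bigcup_(j in [set: nat]) S_ q j.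

Local Open Scope ereal_scope.

Definition dist_to (B : set C) (a : C) : \bar R :=
  ereal_inf [set (normc (a - b))%:E | b in B].

(* Extended-real valued: it is +oo when exactly one of the sets is empty or
   unbounded, so no default values of real suprema can interfere. *)
Definition hausdorff_dist (A B : set C) : \bar R :=
  maxe (ereal_sup [set dist_to B a | a in A])
       (ereal_sup [set dist_to A b | b in B]).

(* Convergence in the space of nonempty compact sets. The first terms may fail
   to be compact (z^n + q(z) may have degree less than 2 for small n).
   Nonemptiness follows from the last condition. *)
Definition hausdorff_cvg (A_ : nat -> set C) (A : set C) : Prop :=
  [/\ compact A, \forall n \near \oo, compact (A_ n) &
      hausdorff_dist (A_ n) A @[n --> \oo] --> 0].

End LimitSet.

(* Main.v *)
(* Write K(f_n) for the filled Julia set. A point leaving the closed unit disc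
   under q leaves it under f_n for n large as well, and f_n expands there, so
   the K(f_n) can only cluster on K_infty.

   Conversely, every point of K_infty is a limit of points of K(f_n).
   - For a point w of the unit circle, fixed points of f_n, i.e. roots of
     z^n + (q(z) - z), cluster at w: this is an instance of Jentzsch's theorem.
   - For a point z of S_j, pull these fixed points back by f_n^j, which
     converges to q^j uniformly near z, by Hurwitz' theorem.
   - A point of K_q that is not interior is a limit of points of the S_j, by
     the intermediate value theorem.
   - An interior point of K_q is in the Fatou set by Montel's theorem, hence
     attracted by a cycle; the cycle lies in the open disc, where f_n is a small
     perturbation of q, so the orbit under f_n is trapped near the cycle.

   Since all functions are polynomials, complex integration is replaced by
   products and sums over the N-th roots of unity. *)
Require Import Defs.
From mathcomp Require Import all_boot all_order all_algebra.
From mathcomp Require Import cyclic separable cyclotomic.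
From mathcomp Require Import complex ring lra.
From mathcomp Require Import all_classical all_reals all_analysis.
Import Order.TTheory GRing.Theory Num.Theory.
Import numFieldNormedType.Exports.
Local Open Scope classical_set_scope.
Local Open Scope complex_scope.
Local Open Scope ring_scope.
Set Implicit Arguments.
Unset Strict Implicit.
Unset Printing Implicit Defensive.

(** * The modulus [normc] on the complex numbers *)

Section Modulus.
Variable R : realType.
Implicit Types (x y z : R[i]).

Lemma norm_normc z : `|z| = (normc z)%:C.
Proof. by case: z. Qed.

Lemma normc_ge0 z : 0 <= normc z.
Proof. by case: z => a b; exact: sqrtr_ge0. Qed.

Lemma normcD_le x y : normc (x + y) <= normc x + normc y.
Proof. exact: (@le_normcD R). Qed.

Lemma normc_opp z : normc (- z) = normc z.
Proof. exact: (@normcN R). Qed.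

Lemma distcC x y : normc (x - y) = normc (y - x).
Proof. by rewrite -normc_opp opprB. Qed.

Lemma distc_triangle y x z : normc (x - z) <= normc (x - y) + normc (y - z).
Proof. by rewrite -[X in normc X](subrKA y) normcD_le. Qed.

Lemma normcB_le x y : normc (x - y) <= normc x + normc y.
Proof. by rewrite -(normc_opp y) normcD_le. Qed.

Lemma normc_lipschitz x y : normc x <= normc y + normc (x - y).
Proof. by rewrite -[X in normc X](subrKC y) normcD_le. Qed.

Lemma normc_real (r : R) : normc r%:C = `|r|.
Proof. by rewrite /= expr0n addr0 sqrtr_sqr. Qed.

Lemma normc_zero : normc (0 : R[i]) = 0.
Proof. exact: Normc.normc0. Qed.

Lemma normc_one : normc (1 : R[i]) = 1.
Proof. exact: Normc.normc1. Qed.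

Lemma normc_eq0 z : (normc z == 0) = (z == 0).
Proof.
apply/eqP/eqP => [|->]; first exact: Normc.eq0_normc.
exact: normc_zero.
Qed.

Lemma normc_gt0 z : (0 < normc z) = (z != 0).
Proof. by rewrite lt_neqAle normc_ge0 andbT eq_sym normc_eq0. Qed.

Lemma normcX z n : normc (z ^+ n) = normc z ^+ n.
Proof.
elim: n => [|n IH]; first by rewrite !expr0 normc_one.
by rewrite !exprS Normc.normcM IH.
Qed.

Lemma normc_prod (I : Type) (s : seq I) (F : I -> R[i]) :
  normc (\prod_(i <- s) F i) = \prod_(i <- s) normc (F i).
Proof. exact: (big_morph _ (@Normc.normcM R) normc_one). Qed.

Lemma normc_sum (I : Type) (s : seq I) (F : I -> R[i]) :
  normc (\sum_(i <- s) F i) <= \sum_(i <- s) normc (F i).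
Proof.
elim: s => [|i s IH]; first by rewrite !big_nil normc_zero.
by rewrite !big_cons (le_trans (normcD_le _ _))// lerD2l.
Qed.

Lemma normc_nat n : normc (n%:R : R[i]) = n%:R.
Proof.
rewrite (_ : n%:R = (n%:R : R)%:C); first by rewrite normc_real ger0_norm.
by rewrite (rmorph_nat (real_complex R)).
Qed.

End Modulus.

(** * Growth and decay of real powers *)

Section Powers.
Variable R : realType.

Lemma bernoulli_ineq (t : R) n : 0 <= t -> 1 + n%:R * t <= (1 + t) ^+ n.
Proof.
move=> t0; elim: n => [|n IH]; first by rewrite mul0r addr0 expr0.
rewrite exprS; apply: le_trans (ler_wpM2l _ IH); last lra.
have n0 : 0 <= n%:R :> R by [].
rewrite -natr1; nra.
Qed.

Lemma expr_unbounded (x M : R) : 1 < x -> \forall n \near \oo, M < x ^+ n.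
Proof.
move=> x1; pose N := (Num.bound (`|M| / (x - 1))).
exists N => // n /= Nn.
have := @archi_boundP _ (`|M| / (x - 1)) _.
rewrite divr_ge0 ?normr_ge0 ?subr_ge0 ?(ltW x1)// => /(_ isT); rewrite -/N.
rewrite ltr_pdivrMr ?subr_gt0// => MN.
have := bernoulli_ineq (t := x - 1) n; rewrite subr_ge0 ltW// => /(_ isT).
rewrite subrKC; apply: lt_le_trans.
have : N%:R * (x - 1) <= n%:R * (x - 1).
  by rewrite ler_wpM2r ?ler_nat// subr_ge0 ltW.
have := ler_norm M; lra.
Qed.

Lemma expr_small (x e : R) : 0 <= x -> x < 1 -> 0 < e ->
  \forall n \near \oo, x ^+ n < e.
Proof.
move=> x0 x1 e0; case: (eqVneq x 0) => [->|xn0].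
  by exists 1%N => // n n1; rewrite expr0n; case: n n1.
have xp : 0 < x by rewrite lt_neqAle eq_sym xn0.
have [|N _ HN] := @expr_unbounded x^-1 e^-1; first by rewrite invf_gt1.
exists N => // n /HN; rewrite exprVn ltf_pV2// posrE ?exprn_gt0//.
Qed.

(** If [A < m], then [(m / A) ^+ N] outgrows [K]. This removes a constant loss from an estimate that
    holds for all powers. *)
Lemma expr_le_cst_le (m A K : R) : 0 <= A ->
  (forall N, (0 < N)%N -> m ^+ N <= A ^+ N * K) -> m <= A.
Proof.
move=> A0 H; rewrite leNgt; apply/negP => Am.
case: (eqVneq A 0) Am => [A00|An0] Am.
  by have := H 1%N isT; rewrite !expr1 A00 mul0r leNgt -A00 Am.
have Ap : 0 < A by rewrite lt_neqAle eq_sym An0.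
have [|N _ HN] := @expr_unbounded (m / A) K; first by rewrite ltr_pdivlMr// mul1r.
have := HN N.+1 (leqnSn _); rewrite ltNge => /negP; apply.
rewrite expr_div_n ler_pdivrMr ?exprn_gt0// mulrC; exact: H.
Qed.

End Powers.

(** * Products and means over roots of unity *)

Section CircleProducts.
Variable R : realType.
Local Notation C := R[i].
Implicit Types (P : {poly C}) (c u : C).

Lemma prodr_const_seq (I : Type) (S : comPzSemiRingType) (s : seq I) (x : S) :
  \prod_(i <- s) x = x ^+ size s.
Proof. by rewrite big_const_seq count_predT iter_mulr_1. Qed.

Lemma unity_roots_seq N : (0 < N)%N ->
  exists s : seq C, size s = N /\ 'X^N - 1 = \prod_(w <- s) ('X - w%:P).
Proof.
move=> N0; have [s Es] := closed_field_poly_normal ('X^N - 1 : {poly C}).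
have lc : lead_coef ('X^N - 1 : {poly C}) = 1.
  by apply/eqP; rewrite -[_ == _]/(_ \is monic) monicXnsubC.
rewrite lc scale1r in Es; exists s; split=> //.
have := congr1 (size : {poly C} -> nat) Es.
by rewrite size_prod_XsubC size_XnsubC// => -[].
Qed.

Lemma unity_roots_norm N (s : seq C) w : (0 < N)%N ->
  'X^N - 1 = \prod_(w <- s) ('X - w%:P) -> w \in s ->
  w ^+ N = 1 /\ normc w = 1.
Proof.
move=> N0 Es ws; have : root ('X^N - 1) w by rewrite Es root_prod_XsubC.
rewrite rootE !hornerE subr_eq0 => /eqP wN; split=> //.
have := congr1 (@normc R) wN; rewrite normcX normc_one => /eqP.
by rewrite pexpr_eq1// ?normc_ge0// => /eqP.
Qed.

(** For [u != 0] this is the factorisation of ['X^N - 1] evaluated at [- y / u] and rescaled by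
    [(- u) ^+ N]. *)
Lemma prod_unity_roots N (s : seq C) (y u : C) : (0 < N)%N -> size s = N ->
  'X^N - 1 = \prod_(w <- s) ('X - w%:P) ->
  \prod_(w <- s) (y + u * w) = y ^+ N - (- u) ^+ N.
Proof.
move=> N0 sN Es; case: (eqVneq u 0) => [->|un0].
  under eq_bigr do rewrite mul0r addr0.
  by rewrite prodr_const_seq sN oppr0 expr0n gtn_eqF// subr0.
have : \prod_(w <- s) (- y / u - w) = (- y / u) ^+ N - 1.
  have := congr1 (horner^~ (- y / u)) Es.
  rewrite horner_prod !hornerE => ->.
  by apply: eq_bigr => w _; rewrite !hornerE.
move=> E; rewrite (eq_bigr (fun w => (- u) * (- y / u - w))); last first.
  by move=> w _; field.
rewrite big_split/= prodr_const_seq sN E mulrBr mulr1.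
by rewrite -exprMn; congr (_ ^+ _ - _); field.
Qed.

(* Jensen's formula in product form: the product over the circle only differs
   from the power of the central value through the factors of the roots. *)
Lemma circle_prod_le N (s : seq C) P c u (e : R) :
  (0 < N)%N -> size s = N -> 'X^N - 1 = \prod_(w <- s) ('X - w%:P) ->
  0 < e -> (forall a, root P a -> e <= normc (c - a)) ->
  \prod_(w <- s) normc P.[c + u * w] <=
    normc P.[c] ^+ N * (1 + (normc u / e) ^+ N) ^+ (size P).-1.
Proof.
move=> N0 sN Es e0 far.
have P0 : P != 0.
  apply/eqP => P0; have := far c; rewrite P0 root0 => /(_ isT).
  by rewrite subrr normc_zero leNgt e0.
have [t Et] := closed_field_poly_normal P.
have lc0 : lead_coef P != 0 by rewrite lead_coef_eq0.
have szt : (size P).-1 = size t.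
  by rewrite Et size_scale// size_prod_XsubC.
have PE x : normc P.[x] = normc (lead_coef P) * \prod_(a <- t) normc (x - a).
  rewrite {1}Et hornerZ horner_prod Normc.normcM normc_prod.
  by congr (_ * _); apply: eq_bigr => a _; rewrite !hornerE.
rewrite (eq_bigr _ (fun w _ => PE _)) big_split/= prodr_const_seq sN.
rewrite PE exprMn -mulrA ler_wpM2l ?exprn_ge0 ?normc_ge0//.
rewrite exchange_big szt -(prodr_const_seq t) -prodrXl -big_split/=.
have : forall a, a \in t -> e <= normc (c - a).
  move=> a at_; apply: far; rewrite Et rootZ//.
  by rewrite root_prod_XsubC.
elim: (t) => [|a t' IH] tH; first by rewrite !big_nil.
rewrite !big_cons; apply: ler_pM.
- by apply: prodr_ge0 => w _; exact: normc_ge0.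
- by apply: prodr_ge0 => a' _; apply: prodr_ge0 => w _; exact: normc_ge0.
- rewrite -normc_prod.
  under eq_bigr do rewrite addrAC.
  rewrite (prod_unity_roots _ _ N0 sN Es).
  apply: le_trans (normcB_le _ _) _; rewrite !normcX normc_opp mulrDr mulr1 lerD2l.
  have ea := tH a (mem_head _ _).
  rewrite -exprMn lerXn2r ?nnegrE ?normc_ge0//.
    by rewrite !mulr_ge0 ?normc_ge0// invr_ge0 ltW.
  rewrite mulrCA ler_peMr ?normc_ge0// ler_pdivlMr// mul1r//.
- by apply: IH => a' a't; apply: tH; rewrite inE a't orbT.
Qed.

(** Minimum modulus principle. With [normc u = e = r] the correction in [circle_prod_le] is
    [2 ^+ (size P).-1] for every [N], and [expr_le_cst_le] removes it. *)
Lemma min_modulus P c (r m : R) : 0 < r -> 0 <= m ->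
  (forall a, root P a -> r <= normc (c - a)) ->
  (forall x, normc (x - c) = r -> m <= normc P.[x]) -> m <= normc P.[c].
Proof.
move=> r0 m0 far Pm.
apply: (expr_le_cst_le (K := 2 ^+ (size P).-1)); first exact: normc_ge0.
move=> N N0; have [s [sN Es]] := unity_roots_seq N0.
have := circle_prod_le r%:C N0 sN Es r0 far.
rewrite normc_real gtr0_norm// divff ?gt_eqF// expr1n; apply: le_trans.
rewrite -sN -(prodr_const_seq s).
rewrite big_seq [leRHS]big_seq; apply: ler_prod => w ws; rewrite m0/=.
apply: Pm; rewrite addrAC subrr add0r Normc.normcM normc_real gtr0_norm//.
by have [_ ->] := unity_roots_norm N0 Es ws; rewrite mulr1.
Qed.

Lemma prim_root_complex N : (0 < N)%N -> exists z : C, N.-primitive_root z.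
Proof.
move=> N0; have [s [sN Es]] := unity_roots_seq N0.
have rN1 : all N.-unity_root s.
  by apply/allP=> w; rewrite -root_prod_XsubC -Es.
have us : uniq s.
  rewrite -separable_prod_XsubC -Es separable_Xn_sub_1//.
  by rewrite pnatr_eq0 -lt0n.
have [|z] := hasP (has_prim_root N0 rN1 us _); first by rewrite sN.
by exists z.
Qed.

(** The mean of a polynomial over [N] equally spaced points of a circle is its value at the centre
    as soon as [N] exceeds the degree. *)
Lemma center_modulus P c (r M : R) : 0 < r ->
  (forall x, normc (x - c) = r -> normc P.[x] <= M) -> normc P.[c] <= M.
Proof.
move=> r0 PM; pose N := (size P).+1.
have [z zN] := @prim_root_complex N isT.
pose Q := P \Po (c%:P + r%:C *: 'X).
have QE x : Q.[x] = P.[c + r%:C * x] by rewrite horner_comp !hornerE.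
have Qsz : (size Q <= N)%N.
  apply: leq_trans (size_comp_poly_leq _ _) _; rewrite ltnS.
  have : (size (c%:P + r%:C *: 'X)%R <= 2)%N.
    rewrite (leq_trans (size_polyD _ _))// geq_max.
    rewrite (leq_trans (size_polyC_leq1 _))//.
    by rewrite (leq_trans (size_scale_leq _ _))// size_polyX.
  case: (size _) => [|[|[|]]]// _; rewrite /= ?muln0 ?muln1//.
  exact: leq_pred.
have sumQ : \sum_(i < N) Q.[z ^+ i] = N%:R * Q.[0].
  under eq_bigr do rewrite (horner_coef_wide _ Qsz).
  rewrite exchange_big/= (bigD1 ord0)//= [X in _ + X]big1 ?addr0.
    under eq_bigr do rewrite expr0 mulr1.
    by rewrite sumr_const card_ord horner_coef0 mulr_natl.
  (* For [0 < k < N] the geometric sum of [z ^+ k] vanishes, since [z ^+ k != 1] by primitivity. *)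
  move=> k k0; rewrite -mulr_sumr.
  under eq_bigr do rewrite exprAC.
  have : (z ^+ k - 1) * (\sum_(i < N) (z ^+ k) ^+ i) = 0.
    by rewrite -subrX1 exprAC (prim_expr_order zN) expr1n subrr.
  move/eqP; rewrite mulf_eq0 subr_eq0 -(prim_order_dvd zN).
  rewrite gtnNdvd ?lt0n//=; first by move/eqP ->; rewrite mulr0.
have z1 : normc z = 1.
  have := congr1 (@normc R) (prim_expr_order zN).
  by rewrite normcX normc_one => /eqP; rewrite pexpr_eq1 ?normc_ge0// => /eqP.
have : normc (N%:R * Q.[0]) <= N%:R * M.
  rewrite -sumQ; apply: le_trans (normc_sum _ _) _.
  rewrite mulr_natl -[X in M *+ X](card_ord N) -sumr_const; apply: ler_sum => i _.
  rewrite QE; apply: PM; rewrite addrAC subrr add0r Normc.normcM normcX z1.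
  by rewrite expr1n mulr1 normc_real gtr0_norm.
by rewrite Normc.normcM normc_nat ler_pM2l ?ltr0n// QE mulr0 addr0.
Qed.

(** Difference quotients of polynomials are polynomials, so modulus estimates apply to [h] itself,
    and its value at [c] is the derivative. *)
Lemma difference_quotient P c : exists2 h : {poly C},
  (forall u, P.[u] - P.[c] = h.[u] * (u - c)) & P^`().[c] = h.[c].
Proof.
have /factor_theorem [h Eh] : root (P - P.[c]%:P) c.
  by rewrite rootE !hornerE subrr.
exists h => [u|]; first by have := congr1 (horner^~ u) Eh; rewrite !hornerE.
have := congr1 (fun g => (deriv g).[c]) Eh.
by rewrite derivB derivC subr0 derivM derivXsubC mulr1 !hornerE subrr mulr0 add0r.
Qed.

(* Schwarz-type estimate: apply [center_modulus] to the difference quotient of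
   [P] at [y], on a circle of radius [r / 2] around [x]. *)
Lemma bounded_lipschitz P c (r M : R) x y : 0 < r ->
  (forall u, normc (u - c) < r -> normc P.[u] <= M) ->
  normc (x - c) < r / 8 -> normc (y - c) < r / 8 ->
  normc (P.[x] - P.[y]) <= 8 * M / r * normc (x - y).
Proof.
move=> r0 PM xr yr.
have [h hE _] := difference_quotient P y.
rewrite hE Normc.normcM ler_wpM2r ?normc_ge0//.
apply: (@center_modulus _ _ (r / 2)); first lra.
move=> u ux; have := distc_triangle x u c; have := distc_triangle y u x.
have := distc_triangle c y x; rewrite (distcC c x) => h1 h2 h3.
have uy : r / 4 <= normc (u - y) by lra.
have : normc (h.[u] * (u - y)) <= 2 * M.
  rewrite -hE; apply: le_trans (normcB_le _ _) _.
  have : normc P.[u] <= M by apply: PM; lra.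
  have : normc P.[y] <= M by apply: PM; lra.
  lra.
rewrite Normc.normcM => h4.
have h5 : normc h.[u] * (r / 4) <= 2 * M.
  by apply: le_trans h4; rewrite ler_wpM2l// normc_ge0.
rewrite ler_pdivlMr//; lra.
Qed.

End CircleProducts.

(** * Growth, Lipschitz bounds and Hurwitz' theorem for polynomials *)

Section PolynomialEstimates.
Variable R : realType.
Local Notation C := R[i].
Implicit Types (p q : {poly C}) (x y z w c : C).

Lemma horner_growth p : exists2 B : R, 0 <= B &
  forall d x M, (size p <= d)%N -> 1 <= M -> normc x <= M ->
    normc p.[x] <= B * M ^+ d.
Proof.
exists (\sum_(i < size p) normc p`_i).
  by rewrite sumr_ge0// => i _; exact: normc_ge0.
move=> d x M pd M1 xM; rewrite horner_coef mulr_suml.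
apply: le_trans (normc_sum _ _) _; apply: ler_sum => i _.
rewrite Normc.normcM ler_wpM2l ?normc_ge0// normcX.
apply: (@le_trans _ _ (M ^+ i)).
  by rewrite lerXn2r ?nnegrE ?normc_ge0// (le_trans ler01).
by rewrite ler_weXn2l// ltnW// (leq_trans (ltn_ord i)).
Qed.

Lemma horner_lipschitz p c (r : R) : 0 < r -> exists2 L : R, 0 <= L &
  forall x y, normc (x - c) < r -> normc (y - c) < r ->
    normc (p.[x] - p.[y]) <= L * normc (x - y).
Proof.
move=> r0; have [B B0 HB] := horner_growth p.
pose M := 1 + normc c + 8 * r.
have M1 : 1 <= M by rewrite /M; have := normc_ge0 c; lra.
exists (8 * (B * M ^+ size p) / (8 * r)).
  by rewrite divr_ge0 ?mulr_ge0 ?exprn_ge0 ?(le_trans ler01 M1) ?(ltW r0).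
move=> x y xc yc; apply: (bounded_lipschitz (c := c)); first by rewrite mulr_gt0.
- move=> u uc; apply: HB => //; have := normc_lipschitz u c; rewrite /M; lra.
- by rewrite [8 * r]mulrC mulfK.
- by rewrite [8 * r]mulrC mulfK.
Qed.

Lemma horner_cont p c (e : R) : 0 < e ->
  exists2 d : R, 0 < d & forall x, normc (x - c) < d -> normc (p.[x] - p.[c]) < e.
Proof.
move=> e0; have [L L0 HL] := @horner_lipschitz p c 1 ltr01.
exists (Num.min 1 (e / (L + 1))).
  by rewrite lt_min ltr01 divr_gt0//; lra.
move=> x; rewrite lt_min => /andP[x1 xe].
apply: le_lt_trans (HL _ _ x1 _) _; first by rewrite subrr normc_zero.
move: xe; rewrite ltr_pdivlMr; last lra.
by apply: le_lt_trans; have := normc_ge0 (x - c); nra.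
Qed.

Lemma avoid_seq (s : seq R) (a b : R) : a < b ->
  exists r, [/\ a < r, r < b & r \notin s].
Proof.
elim: s a b => [|x s IH] a b ab; first by exists ((a + b) / 2); split => //; lra.
have [xb|bx] := ltP x b; last first.
  have [r [ar rb rs]] := IH _ _ ab; exists r; split=> //.
  by rewrite inE negb_or rs andbT lt_eqF// (lt_le_trans rb).
have [|r [ar rb rs]] := IH (Num.max a x) b; first by rewrite gt_max ab.
move: ar; rewrite gt_max => /andP[ar xr]; exists r; split=> //.
by rewrite inE negb_or rs andbT gt_eqF.
Qed.

Lemma poly_roots_seq p : p != 0 -> exists s : seq C, forall a, root p a = (a \in s).
Proof.
move=> p0; have [s Es] := closed_field_poly_normal p; exists s => a.
by rewrite Es rootZ ?lead_coef_eq0// root_prod_XsubC.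
Qed.

(** The circle of radius [r] avoids the roots of [p], so [normc p.[x]] has a positive lower bound on
    it. If [g] is within a third of this bound and has no root in the disc, [min_modulus] gives two
    thirds of it at [c], where [p] vanishes and [g] is at most one third. *)
Lemma hurwitz p c (e : R) : p != 0 -> root p c -> 0 < e ->
  exists r m : R, [/\ 0 < r, r < e, 0 < m &
    forall g : {poly C}, (forall x, normc (x - c) <= r -> normc (g.[x] - p.[x]) <= m) ->
      exists2 a, normc (a - c) < r & g.[a] = 0].
Proof.
move=> p0 pc e0; have [s Es] := closed_field_poly_normal p.
have [r [r0 re rs]] := avoid_seq [seq normc (a - c) | a <- s] e0.
pose m := normc (lead_coef p) * \prod_(a <- s) `|normc (a - c) - r|.
have m0 : 0 < m.
  rewrite mulr_gt0 ?normc_gt0 ?lead_coef_eq0// big_seq prodr_gt0// => a as_.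
  rewrite normr_gt0 subr_eq0; apply: contra rs => /eqP <-.
  exact: map_f.
have pm x : normc (x - c) = r -> m <= normc p.[x].
  move=> xr; rewrite Es hornerZ horner_prod Normc.normcM normc_prod.
  rewrite ler_wpM2l ?normc_ge0//; apply: ler_prod => a _; rewrite normr_ge0/=.
  rewrite !hornerE; have := distc_triangle x a c; have := distc_triangle a x c.
  by rewrite (distcC x a) ler_norml; lra.
exists r, (m / 3); split=> //; first lra.
move=> g gp; apply: contrapT => noroot.
have : m / 3 * 2 <= normc g.[c].
  apply: (min_modulus (r := r)) => //; first lra.
    move=> a ga; rewrite leNgt; apply/negP => ar; apply: noroot; exists a.
      by rewrite distcC.
    exact/eqP.
  move=> x xr; have := gp x; rewrite xr lexx => /(_ isT).
  have := pm _ xr; have := normc_lipschitz p.[x] g.[x].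
  by rewrite (distcC p.[x]); lra.
have := gp c; rewrite subrr normc_zero ltW// => /(_ isT).
by rewrite (eqP pc) subr0; lra.
Qed.

End PolynomialEstimates.

(** * Roots of z^n + p(z) near the unit circle *)

Section RootsNearCircle.
Variable R : realType.
Local Notation C := R[i].
Implicit Types (p q : {poly C}) (x y z w c u : C).

(** Inside the circle [x ^+ n] tends to 0 and [p.[x]] survives; outside it [x ^+ n] dominates
    [p.[x]]. *)
Lemma perturbed_power_lower p x : normc x != 1 -> p.[x] != 0 ->
  exists2 c : R, 0 < c & \forall n \near \oo, c <= normc (x ^+ n + p.[x]).
Proof.
move=> x1 px; have px0 : 0 < normc p.[x] by rewrite normc_gt0.
have [xlt|xgt] := ltP (normc x) 1.
  have p2 : 0 < normc p.[x] / 2 by rewrite divr_gt0.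
  exists (normc p.[x] / 2) => //; apply: filterS (expr_small (normc_ge0 x) xlt p2).
  move=> n; rewrite -normcX => H.
  have := normc_lipschitz p.[x] (p.[x] + x ^+ n).
  rewrite opprD addrA subrr add0r normc_opp [p.[x] + _]addrC. lra.
exists 1 => //; have {}xgt : 1 < normc x by rewrite lt_neqAle eq_sym x1.
apply: filterS (expr_unbounded (1 + normc p.[x]) xgt) => n; rewrite -normcX => H.
have := normc_lipschitz (x ^+ n) (x ^+ n + p.[x]).
rewrite opprD addrA subrr add0r normc_opp; lra.
Qed.

Lemma perturbed_power_prod_lower p (t : seq C) :
  (forall x, x \in t -> normc x != 1 /\ p.[x] != 0) ->
  exists2 c : R, 0 < c &
    \forall n \near \oo, c <= \prod_(x <- t) normc (x ^+ n + p.[x]).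
Proof.
elim: t => [|x t IH] H; first by exists 1 => //; exists 0%N => // n _; rewrite big_nil.
have [|c c0 Hc] := IH; first by move=> y yt; apply: H; rewrite inE yt orbT.
have [x1 px] := H x (mem_head _ _).
have [d d0 Hd] := perturbed_power_lower x1 px.
exists (d * c); first exact: mulr_gt0.
near=> n; rewrite big_cons; apply: ler_pM; [exact: ltW|exact: ltW| |].
  by near: n.
by near: n.
Unshelve. all: by end_near. Qed.

Lemma generic_radius p w (s : seq C) (a b : R) : p != 0 -> normc w = 1 ->
  (forall u, u \in s -> normc u = 1) -> 0 <= a -> a < b ->
  exists r : R, [/\ a < r, r < b & forall u, u \in s ->
    normc (w + r%:C * w * u) != 1 /\ p.[w + r%:C * w * u] != 0].
Proof.
move=> p0 w1 s1 a0 ab.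
suff [bad Hbad] : exists bad : seq R, forall r, 0 < r -> r \notin bad ->
    forall u, u \in s -> normc (w + r%:C * w * u) != 1 /\ p.[w + r%:C * w * u] != 0.
  have [r [ar rb rbad]] := avoid_seq bad ab; exists r; split=> //.
  by apply: Hbad => //; exact: le_lt_trans ar.
have w0 : w != 0 by rewrite -normc_gt0 w1.
elim: s s1 => [|u s IH] s1; first by exists [::].
have [|bad Hbad] := IH; first by move=> v vs; apply: s1; rewrite inE vs orbT.
have u1 := s1 u (mem_head _ _).
have u0 : u != 0 by rewrite -normc_gt0 u1.
pose g := p \Po (w%:P + (w * u) *: 'X).
have g0 : g != 0.
  rewrite -size_poly_eq0 /g size_comp_poly2 ?size_poly_eq0//.
  by rewrite addrC size_polyDl size_scale ?mulf_neq0// size_polyX// size_polyC w0.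
have [t Ht] := poly_roots_seq g0.
(* As [normc u = 1], the equation [normc (1 + r%:C * u) = 1] reduces to
   [r * (r + 2 * complex.Re u) = 0]. The real parts of the roots of [g] cover the radii at which [p]
   vanishes. *)
exists (- 2 * complex.Re u :: [seq complex.Re a | a <- t] ++ bad) => r r0.
rewrite inE mem_cat !negb_or => /and3P[ru rt rbad] v.
rewrite inE => /predU1P[->|]; last exact: Hbad.
split; last first.
  apply: contra rt => /eqP gr; apply/mapP; exists r%:C => //.
  rewrite -Ht rootE horner_comp !hornerE; apply/eqP; rewrite -[RHS]gr.
  by congr (p.[_ + _]); rewrite mulrC mulrA.
have -> : w + r%:C * w * u = w * (1 + r%:C * u) by ring.
rewrite Normc.normcM w1 mul1r; apply: contra ru.
case: u u1 {u0 g g0 t rt Ht s1} => x y /= /(congr1 (fun t => t ^+ 2)) u1.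
move=> /eqP/(congr1 (fun t => t ^+ 2)).
rewrite !sqr_sqrtr ?addr_ge0 ?sqr_ge0// in u1 *.
rewrite expr1n in u1; rewrite expr1n => E.
have rn0 : r != 0 by rewrite gt_eqF.
have : r * (r + 2 * x) = r * 0 by nra.
by move=> /(mulfI rn0) rx; apply/eqP; lra.
Qed.

(* Jentzsch's theorem for [z^n + p(z)]. If the disc of radius [e] about [w] has
   no root, the product formula bounds the geometric mean over a circle of
   radius [r < e] about [w] by a constant times [(1 + (r / e) ^+ N) ^+ n],
   whereas the factor of the point [w * (1 + r)] alone grows like
   [(1 + r) ^+ n]. *)
Lemma root_near_circle p w (e : R) : p != 0 -> normc w = 1 -> 0 < e ->
  \forall n \near \oo, exists2 a, normc (a - w) < e & a ^+ n + p.[a] = 0.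
Proof.
move=> p0 w1; wlog e1 : e / e <= 1 => [H e0|e0].
  have [e1|e1] := leP e 1; first exact: H.
  apply: filterS (H 1 (lexx _) ltr01) => n [a aw pa]; exists a => //.
  exact: lt_trans e1.
have e4 : 0 < e / 4 by lra.
have h0 : 0 <= 1 / 2 :> R by lra.
have h1 : 1 / 2 < 1 :> R by lra.
(* As [r] will lie between [e / 4] and [e / 2], this [N] gives
   [(r / e) ^+ N <= (1 / 2) ^+ N < e / 4 < r], so the rate [1 + (r / e) ^+ N] stays below
   [1 + r]. *)
have [N0 _ HN0] := expr_small h0 h1 e4.
have {HN0} := HN0 N0.+1 (leqnSn _); set N := N0.+1 => HN.
have Npos : (0 < N)%N by [].
have [s [sN Es]] := @unity_roots_seq R _ Npos.
have s1 u : u \in s -> normc u = 1 by case/(unity_roots_norm Npos Es).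
have e42 : e / 4 < e / 2 by lra.
have [r [r1 r2 Hr]] := generic_radius p0 w1 s1 (ltW e4) e42.
have s_1 : 1 \in s.
  by rewrite -root_prod_XsubC -Es rootE !hornerE expr1n subrr.
have [|c c0 Hc] := @perturbed_power_prod_lower p [seq w + r%:C * w * u | u <- rem 1 s].
  by move=> x /mapP[u us ->]; apply: Hr; exact: mem_rem us.
pose K := 1 + normc p.[w]; pose x1 := w + r%:C * w * 1.
have x1n : normc x1 = 1 + r.
  rewrite /x1 mulr1 -[X in X + _]mul1r -mulrDl Normc.normcM w1 mulr1.
  rewrite (_ : 1 + r%:C = (1 + r)%:C) ?normc_real ?gtr0_norm//; first lra.
  by rewrite rmorphD.
have gt1 : 1 < (1 + r) / (1 + e / 4) by rewrite ltr_pdivlMr; lra.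
near=> n; apply: contrapT => noroot.
have far a : root ('X^n + p) a -> e <= normc (w - a).
  rewrite rootE !hornerE => /eqP pa; rewrite leNgt; apply/negP => ae.
  by apply: noroot; exists a => //; rewrite distcC.
have := circle_prod_le (r%:C * w) Npos sN Es e0 far.
apply/negP; rewrite -ltNge.
(* The factor of [u = 1] is set apart; the product of the others is at least [c] for large [n]. *)
rewrite (big_rem _ s_1)/=.
have -> : \prod_(u <- rem 1 s) normc ('X^n + p).[w + r%:C * w * u] =
   \prod_(x <- [seq w + r%:C * w * u | u <- rem 1 s]) normc (x ^+ n + p.[x]).
  by rewrite big_map; apply: eq_bigr => u _; rewrite !hornerE.
have Hcn : c <= \prod_(x <- [seq w + r%:C * w * u | u <- rem 1 s])
   normc (x ^+ n + p.[x]) by near: n.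
have big : K ^+ N * 2 / c < ((1 + r) / (1 + e / 4)) ^+ n.
  by near: n; exact: expr_unbounded.
have half : normc p.[x1] * 2 < (1 + r) ^+ n.
  by near: n; apply: expr_unbounded; lra.
have szn : (size ('X^n + p)).-1 = n.
  by rewrite size_polyDl size_polyXn// ltnS; near: n; exact: nbhs_infty_ge.
rewrite szn Normc.normcM w1 mulr1 normc_real gtr0_norm; last lra.
apply: (@le_lt_trans _ _ (K ^+ N * (1 + e / 4) ^+ n)).
  apply: ler_pM; rewrite ?exprn_ge0 ?normc_ge0//.
  - by rewrite addr_ge0// exprn_ge0// divr_ge0//; lra.
  - rewrite lerXn2r ?nnegrE ?normc_ge0//; first by rewrite addr_ge0 ?normc_ge0.
    rewrite !hornerE (le_trans (normcD_le _ _))// normcX w1 expr1n//.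
  - rewrite lerXn2r ?nnegrE//; first by rewrite addr_ge0// exprn_ge0// divr_ge0//; lra.
      lra.
    rewrite lerD2l ltW// (le_lt_trans _ HN)// lerXn2r ?nnegrE//.
    + by rewrite divr_ge0//; lra.
    + by rewrite ler_pdivrMr//; lra.
apply: (@lt_le_trans _ _ ((1 + r) ^+ n / 2 * c)); last first.
  apply: ler_pM => //; [by rewrite divr_ge0// exprn_ge0//; lra|exact: ltW|].
  rewrite hornerD hornerXn -/x1.
  have := normc_lipschitz (x1 ^+ n) (x1 ^+ n + p.[x1]).
  rewrite opprD addrA subrr add0r normc_opp normcX x1n; lra.
move: big; rewrite ltr_pdivrMr// expr_div_n mulrAC ltr_pdivlMr; last first.
  by rewrite exprn_gt0//; lra.
set A := K ^+ N; set B := (1 + e / 4) ^+ n; set D := (1 + r) ^+ n; lra.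
Unshelve. all: by end_near. Qed.

End RootsNearCircle.

(** * Iterates of q and of its perturbations z^n + q(z) *)

Section Iterates.
Variable R : realType.
Local Notation C := R[i].
Implicit Types (p q : {poly C}) (x y z w c : C).

Definition comp_iter p k : {poly C} := iter k (fun r => p \Po r) 'X.

Lemma horner_comp_iter p k x : (comp_iter p k).[x] = iter k (horner p) x.
Proof.
by elim: k => [|k IH]; rewrite /comp_iter/= ?hornerX// horner_comp IH.
Qed.

Lemma horner_comp_iter_ext p k : iter k (horner p) = horner (comp_iter p k).
Proof. by apply/funext => x; rewrite horner_comp_iter. Qed.

Lemma size_comp_iter p k : (1 < size p)%N -> (1 < size (comp_iter p k))%N.
Proof.
move=> p1; elim: k => [|k IH]; first by rewrite /= size_polyX.
have := size_comp_poly p (comp_iter p k); rewrite -/(comp_iter p k.+1).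
case: (size (comp_iter p k)) IH => [|[|m]]// _.
case: (size p) p1 => [|[|l]]// _.
by case: (size _) => [|[|]].
Qed.

(** Finitely many strict inequalities persist near [z] with a common margin; having [rho < 1] makes
    [x ^+ n] decay uniformly along these orbits. *)
Lemma near_orbit_bound q z j :
  (forall l, (l < j)%N -> normc (iter l (horner q) z) < 1) ->
  exists rho d : R, [/\ 0 <= rho, rho < 1, 0 < d & forall x, normc (x - z) < d ->
    forall l, (l < j)%N -> normc (iter l (horner q) x) <= rho].
Proof.
elim: j => [|j IH] H; first by exists 0, 1; split.
have [l lj|rho [d [r0 r1 d0 Hd]]] := IH; first exact: H (ltnW _).
pose m := normc (iter j (horner q) z).
have m1 : m < 1 by apply: H.
have e0 : 0 < (1 - m) / 2 by lra.
have [d' d'0 Hd'] := horner_cont (comp_iter q j) z e0.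
exists (Num.max rho ((1 + m) / 2)), (Num.min d d'); split.
- by rewrite le_max r0.
- by rewrite gt_max r1/=; lra.
- by rewrite lt_min d0.
move=> x; rewrite lt_min => /andP[xd xd'] l; rewrite ltnS leq_eqVlt le_max.
case/predU1P => [->|lj]; last by rewrite Hd.
apply/orP; right; have := Hd' _ xd'; rewrite !horner_comp_iter.
have := normc_lipschitz (iter j (horner q) x) (iter j (horner q) z).
by rewrite -/m; lra.
Qed.

(** While the orbit under [q] stays within [rho], the perturbed one stays within [(1 + rho) / 2],
    where the added power tends to 0 uniformly. Only times before [j] are constrained, so the [j]-th
    iterate itself may leave the disc. *)
Lemma perturbed_iter_cvg q (E : set C) (rho : R) j : 0 <= rho -> rho < 1 ->
  (forall l x, (l < j)%N -> E x -> normc (iter l (horner q) x) <= rho) ->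
  forall e : R, 0 < e -> \forall n \near \oo, forall x, E x ->
    normc (iter j (horner ('X^n + q)) x - iter j (horner q) x) <= e.
Proof.
move=> r0 r1; elim: j => [|j IH] H e e0.
  by apply: nearW => n x _; rewrite subrr normc_zero ltW.
have [L L0 HL] := @horner_lipschitz R q 0 1 ltr01.
pose e1 := Num.min ((1 - rho) / 2) (e / (2 * (L + 1))).
have L1 : 0 < 2 * (L + 1) by lra.
have e10 : 0 < e1.
  by rewrite lt_min divr_gt0// ?divr_gt0//; lra.
have e11 : e1 <= (1 - rho) / 2 by rewrite ge_min lexx.
have e12 : e1 * (2 * (L + 1)) <= e by rewrite -ler_pdivlMr// ge_min lexx orbT.
have {}IH := IH (fun l x lj => H l x (ltnW lj)) e1 e10.
have h0 : 0 <= (1 + rho) / 2 by lra.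
have h1 : (1 + rho) / 2 < 1 by lra.
have e2 : 0 < e / 2 by lra.
near=> n => x Ex; rewrite !iterS.
have : normc (iter j (horner ('X^n + q)) x - iter j (horner q) x) <= e1.
  by move: x Ex; near: n.
have := H j x (ltnSn _) Ex.
set y := iter j (horner ('X^n + q)) x; set w := iter j (horner q) x => wr yw.
have yr : normc y <= (1 + rho) / 2 by have := normc_lipschitz y w; lra.
have -> : ('X^n + q).[y] - q.[w] = y ^+ n + (q.[y] - q.[w]).
  by rewrite hornerD hornerXn addrA.
have : normc (q.[y] - q.[w]) <= L * normc (y - w) by apply: HL; rewrite subr0; lra.
have : normc (y ^+ n) <= e / 2.
  rewrite normcX; apply: (@le_trans _ _ (((1 + rho) / 2) ^+ n)).
    by rewrite lerXn2r ?nnegrE ?normc_ge0.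
  by rewrite ltW//; near: n; exact: expr_small.
have := normcD_le (y ^+ n) (q.[y] - q.[w]).
have := normc_ge0 (y - w); nra.
Unshelve. all: by end_near. Qed.

(** Here [normc w ^+ n] is at least [(B + 2) * normc w ^+ D], while [normc q.[w]] is at most
    [B * normc w ^+ D]. The threshold on [n] depends on [d] but not on [w]. *)
Lemma perturbed_escape q (d : R) : 0 < d -> \forall n \near \oo, forall w,
  1 + d <= normc w -> 2 * normc w <= normc ('X^n + q).[w].
Proof.
move=> d0; have [B B0 HB] := horner_growth q.
pose D := (size q).+1.
have d1 : 1 < 1 + d by lra.
have [N _ HN] := expr_unbounded (B + 2) d1.
exists (N + D)%N => // n /= Nn w wd.
have w1 : 1 <= normc w by lra.
have := HB D w (normc w) (leqnSn _) w1 (lexx _).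
have : B + 2 <= normc w ^+ (n - D).
  apply: (@le_trans _ _ ((1 + d) ^+ (n - D))).
    by apply/ltW/HN; rewrite /= leq_subRL ?(leq_trans _ Nn) ?leq_addl// addnC.
  by rewrite lerXn2r ?nnegrE//; lra.
have : normc w <= normc w ^+ D by rewrite -[X in X <= _]expr1 ler_weXn2l.
have := normc_lipschitz (w ^+ n) (w ^+ n + q.[w]).
rewrite opprD addrA subrr add0r normc_opp normcX hornerD hornerXn.
have -> : normc w ^+ n = normc w ^+ D * normc w ^+ (n - D).
  by rewrite -exprD subnKC// (leq_trans _ Nn)// leq_addl.
move=> h1 h2 h3 h4.
have : normc w ^+ D * (B + 2) <= normc w ^+ D * normc w ^+ (n - D).
  by apply: ler_wpM2l => //; apply: exprn_ge0; exact: normc_ge0.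
lra.
Qed.

Lemma iter_fixed (f : C -> C) z k : f z = z -> iter k f z = z.
Proof. by move=> fz; elim: k => //= k ->. Qed.

Lemma filled_julia_shift (f : C -> C) z j :
  filled_julia f (iter j f z) -> filled_julia f z.
Proof.
case=> M HM; exists (Num.max M (\big[Num.max/0]_(i < j) normc (iter i f z))) => k.
rewrite le_max; have [kj|jk] := ltnP k j.
  apply/orP; right.
  exact: (le_bigmax _ (fun i : 'I_j => normc (iter i f z)) (Ordinal kj)).
by rewrite -(subnK jk) iterD HM.
Qed.

Lemma filled_julia_iter (f : C -> C) z j :
  filled_julia f z -> filled_julia f (iter j f z).
Proof. by case=> M HM; exists M => k; rewrite -iterD. Qed.

Lemma perturbed_escape_iter q (d : R) : 0 < d -> \forall n \near \oo, forall w k,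
  1 + d <= normc w -> 2 ^+ k <= normc (iter k (horner ('X^n + q)) w).
Proof.
move=> d0; apply: filterS (perturbed_escape q d0) => n H w k wd.
suff : 2 ^+ k <= normc (iter k (horner ('X^n + q)) w) /\
    1 + d <= normc (iter k (horner ('X^n + q)) w) by case.
elim: k => [|k [IH1 IH2]]; first by rewrite expr0; split=> //=; lra.
by have := H _ IH2; rewrite iterS exprS => ?; split; lra.
Qed.

(** From modulus 2 on, orbits at least double at each step, so an orbit returning infinitely often
    below [M] never exceeds 2. It then suffices to control an orbit along a subsequence of times. *)
Lemma recurrent_filled_julia q : \forall n \near \oo, forall z (M : R),
  (forall N, exists2 i, (N <= i)%N & normc (iter i (horner ('X^n + q)) z) <= M) ->
  filled_julia (horner ('X^n + q)) z.
Proof.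
apply: filterS (perturbed_escape_iter q ltr01) => n H z M rec.
exists 2 => k; rewrite leNgt; apply/negP => zk.
have [|N _ HN] := @expr_unbounded R 2 M; first lra.
have [i Ni] := rec (N + k)%N.
have ki : (k <= i)%N := leq_trans (leq_addl _ _) Ni.
rewrite -(subnK ki) iterD.
have /= := HN (i - k)%N; rewrite leq_subRL// addnC => /(_ Ni).
have := H (iter k (horner ('X^n + q)) z) (i - k)%N; lra.
Qed.

Lemma filled_julia_bound q (d : R) : 0 < d -> \forall n \near \oo, forall z,
  filled_julia (horner ('X^n + q)) z -> normc z < 1 + d.
Proof.
move=> d0; apply: filterS (perturbed_escape_iter q d0) => n H z [M HM].
rewrite ltNge; apply/negP => zd.
have [|N _ HN] := @expr_unbounded R 2 M; first lra.
have := HN N (leqnn _); have := H z N zd; have := HM N.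
by move=> ? ? ?; lra.
Qed.

(** One half of the Hausdorff limit in pointwise form: the threshold on [n] may depend on [z], and
    compactness of [K_infty q] restores uniformity later. *)
Definition approached q z := forall e : R, 0 < e -> \forall n \near \oo,
  exists2 a, filled_julia (horner ('X^n + q)) a & normc (a - z) < e.

Lemma approached_closed q z :
  (forall e : R, 0 < e -> exists2 w, approached q w & normc (w - z) < e) ->
  approached q z.
Proof.
move=> H e e0; have e2 : 0 < e / 2 by lra.
have [w aw wz] := H _ e2; apply: filterS (aw _ e2) => n [a Ka az].
by exists a => //; have := distc_triangle w a z; lra.
Qed.

Lemma S_approached q j z : (2 < size q)%N -> S_ q j z -> approached q z.
Proof.
move=> q2 [zj zl] e e0; have q1 : (1 < size q)%N by exact: ltnW.
have [rho [d [r0 r1 d0 Hd]]] := near_orbit_bound zl.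
set w := iter j (horner q) z in zj.
pose P := comp_iter q j - w%:P.
have P0 : P != 0.
  rewrite subr_eq0; apply/eqP => E; have := size_comp_iter j q1.
  by rewrite E size_polyC; case: (w != 0).
have Pz : root P z by rewrite rootE !hornerE horner_comp_iter subrr.
have ed : 0 < Num.min e d by rewrite lt_min e0.
have [r [m [rp re m0 Hm]]] := hurwitz P0 Pz ed.
move: re; rewrite lt_min => /andP[re rd].
have m2 : 0 < m / 2 by lra.
have cvg := @perturbed_iter_cvg q [set x | normc (x - z) <= r] rho j r0 r1 _ _ m2.
have qX0 : q - 'X != 0.
  by rewrite subr_eq0; apply/eqP => E; rewrite E size_polyX in q2.
have roots := root_near_circle qX0 zj m2.
near=> n.
have [b bw /eqP] : exists2 a, normc (a - w) < m / 2 & a ^+ n + (q - 'X).[a] = 0.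
  by near: n.
rewrite hornerD hornerN hornerX addrA subr_eq0 => /eqP bfix.
have conv : forall x, normc (x - z) <= r ->
    normc (iter j (horner ('X^n + q)) x - iter j (horner q) x) <= m / 2.
  by near: n; apply: cvg => l x lj /= xr; apply: Hd => //; lra.
(* This polynomial differs from [P] by the error of the [j]-th iterate and by [b - w], each at most
   [m / 2]; its root [a] is mapped to the fixed point [b]. *)
have [|a ar /eqP] := Hm (comp_iter ('X^n + q) j - b%:P).
  move=> x /conv; rewrite !hornerE !horner_comp_iter => xc.
  set A := iter j _ x in xc *; set D := iter j _ x in xc *.
  have -> : A - b - (D - w) = (A - D) - (b - w) by ring.
  by have := normcB_le (A - D) (b - w); lra.
rewrite !hornerE horner_comp_iter subr_eq0 => /eqP ab.
exists a; last by lra.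
apply: (@filled_julia_shift _ _ j); rewrite ab.
by exists (normc b) => k; rewrite iter_fixed// !hornerE.
Unshelve. all: by end_near. Qed.

(** The gap [r - r'] absorbs the perturbation, so the [k]-th iterate of ['X^n + q] maps the disc of
    radius [r] about [a] into itself. The perturbed orbit of [z] enters this disc, hence [z] itself
    lies in the filled Julia set for large [n]. *)
Lemma trap_approached q z a j k (r r' rho : R) : (0 < k)%N -> r' < r ->
  0 <= rho -> rho < 1 ->
  (forall l, (l < j)%N -> normc (iter l (horner q) z) < 1) ->
  normc (iter j (horner q) z - a) < r ->
  (forall l x, (l < k)%N -> normc (x - a) <= r ->
     normc (iter l (horner q) x) <= rho) ->
  (forall x, normc (x - a) <= r -> normc (iter k (horner q) x - a) <= r') ->
  approached q z.
Proof.
move=> k0 rr r0 r1 zl zj Hr Htrap e e0.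
have [rho' [d [r'0 r'1 d0 Hd]]] := near_orbit_bound zl.
set w := iter j (horner q) z in zj.
have wa : 0 < (r - normc (w - a)) / 2 by lra.
have r'r : 0 < r - r' by lra.
have cvg1 := @perturbed_iter_cvg q [set x | normc (x - a) <= r] rho k r0 r1 Hr _ r'r.
have cvg2 := @perturbed_iter_cvg q [set z] rho' j r'0 r'1 _ _ wa.
have rec := recurrent_filled_julia q.
near=> n; exists z; last by rewrite subrr normc_zero.
apply: (@filled_julia_shift _ _ j).
have C1 : forall x, normc (x - a) <= r ->
    normc (iter k (horner ('X^n + q)) x - iter k (horner q) x) <= r - r'.
  by near: n; exact: cvg1.
have C2 : forall x, x = z ->
    normc (iter j (horner ('X^n + q)) x - iter j (horner q) x) <= (r - normc (w - a)) / 2.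
  by near: n; apply: cvg2 => l x lj ->; apply: Hd => //; rewrite subrr normc_zero.
have {C2} := C2 z erefl; rewrite -/w; set y := iter j _ z => yw.
have ya : normc (y - a) <= r by have := distc_triangle w y a; lra.
have trap i : normc (iter (i * k) (horner ('X^n + q)) y - a) <= r.
  elim: i => [//|i IH]; rewrite mulSn iterD.
  set x := iter (i * k) _ y in IH *.
  have := distc_triangle (iter k (horner q) x) (iter k (horner ('X^n + q)) x) a.
  by have := C1 _ IH; have := Htrap _ IH; lra.
have Rn : forall z M, (forall N, exists2 i, (N <= i)%N &
    normc (iter i (horner ('X^n + q)) z) <= M) -> filled_julia (horner ('X^n + q)) z.
  by near: n.
apply: (Rn _ (r + normc a)) => N; exists (N * k)%N; first exact: leq_pmulr.
by have := normc_lipschitz (iter (N * k) (horner ('X^n + q)) y) a; have := trap N; lra.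
Unshelve. all: by end_near. Qed.

End Iterates.

(** * Topology of the complex plane and derivatives of polynomials *)

Section Topology.
Variable R : realType.
Local Notation C := R[i].
Implicit Types (p q : {poly C}) (x y z w c : C).

(** Balls of the normed space have radii in [R[i]]; a positive one is real, so real radii describe
    the same neighbourhoods. *)
Lemma nbhs_normcP x (U : set C) : nbhs x U <->
  exists2 e : R, 0 < e & forall y, normc (y - x) < e -> U y.
Proof.
split.
  move=> /nbhs_ballP[e /= e0 He]; have /complex_realP[r re] := gtr0_real e0.
  exists r; first by move: e0; rewrite re -(ltcR 0 r).
  move=> y yx; apply: He; rewrite -ball_normE /= re norm_normc ltcR distcC//.
case=> e e0 He; apply/nbhs_ballP; exists e%:C => /=; first by rewrite ltcR.
move=> y; rewrite -ball_normE /= norm_normc ltcR distcC; exact: He.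
Qed.

Lemma normc_continuous : continuous (@normc R : C -> R).
Proof.
move=> x U /nbhs_ballP[e /= e0 He]; apply/nbhs_normcP; exists e => // y yx.
apply: He; rewrite /ball/=.
have := normc_lipschitz x y; have := normc_lipschitz y x; rewrite (distcC x y).
by rewrite ltr_norml => ? ?; apply/andP; split; lra.
Qed.

Lemma horner_continuous p : continuous (horner p : C -> C).
Proof.
move=> x U /nbhs_normcP[e e0 He]; have [d d0 Hd] := horner_cont p x e0.
by apply/nbhs_normcP; exists d => // y /Hd; exact: He.
Qed.

Lemma iter_horner_continuous p k : continuous (iter k (horner p) : C -> C).
Proof.
by rewrite horner_comp_iter_ext; exact: horner_continuous.
Qed.

Lemma compact_normc_ball (r : R) : compact [set z : C | normc z <= r].
Proof.
pose f (u : R * R) : C := u.1 +i* u.2.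
have fc : continuous f.
  move=> [a b] U /nbhs_normcP[e e0 He].
  have e2 : 0 < e / 2 by lra.
  exists (ball a (e / 2), ball b (e / 2)); first by split; exact: nbhsx_ballx.
  move=> [a' b'] /= [aa bb]; apply: He.
  have -> : f (a', b') - f (a, b) = (a' - a)%:C + 'i%C * (b' - b)%:C.
    by rewrite /f/=; simpc.
  apply: le_lt_trans (normcD_le _ _) _; rewrite Normc.normcM !normc_real.
  have -> : normc ('i%C : C) = 1 by rewrite /= expr0n expr1n add0r sqrtr1.
  by move: aa bb; rewrite /ball/= (distrC a) (distrC b); lra.
apply: (@subclosed_compact _ _ (f @` (`[- r, r] `*` `[- r, r]))).
- apply: (closed_comp (f := @normc R : C -> R) (D := [set t | t <= r])).
    by move=> z _; exact: normc_continuous.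
  exact: closed_le.
- apply: continuous_compact.
    by apply: continuous_subspaceT => z; exact: fc.
  by apply: compact_setX; exact: segment_compact.
- move=> [a b] /= zr; exists (a, b) => //=.
  have H (u v : R) : Num.sqrt (u ^+ 2 + v ^+ 2) <= r -> u \in `[- r, r].
    move=> uv; rewrite in_itv/= -ler_norml -sqrtr_sqr; apply: le_trans uv.
    by rewrite ler_wsqrtr// lerDl sqr_ge0.
  by split; [exact: H zr|apply: (H b a); rewrite addrC].
Qed.

Lemma derive1_horner p c : derive1 (horner p : C -> C) c = p^`().[c].
Proof.
have [h hE ->] := difference_quotient p c.
apply: cvg_lim => //=.
move=> U /nbhs_normcP[e e0 He]; have [d d0 Hd] := horner_cont h c e0.
apply/nbhs_normcP; exists d => // t; rewrite subr0 => td t0.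
apply: He; rewrite /= hE addrK.
have -> : t^-1 *: (h.[t + c] * t) = h.[t + c].
  by rewrite /GRing.scale/= mulrCA mulVf ?mulr1.
by apply: Hd; rewrite addrK.
Qed.

End Topology.

(** * Attracting cycles and their basins *)

Section AttractingCycles.
Variable R : realType.
Local Notation C := R[i].
Implicit Types (p q : {poly C}) (x y z w c a : C).

Lemma comp_iterSr q k : comp_iter q k.+1 = comp_iter q k \Po q.
Proof.
elim: k => [|k IH]; first by rewrite /comp_iter/= comp_polyXr comp_polyX.
transitivity (q \Po (comp_iter q k \Po q)); first by rewrite -IH.
exact: comp_polyA.
Qed.

(** The multiplier is constant along a cycle: the chain rule, applied at one point with [q] as inner
    map and at the next with [q] as outer map, yields the same two factors. *)
Lemma attracting_periodic_iter q k a i :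
  attracting_periodic q k a -> attracting_periodic q k (iter i (horner q) a).
Proof.
move=> H; elim: i => [|i [k0 fixa]]; first exact: H.
set b := iter i (horner q) a in fixa *.
move=> lam; rewrite horner_comp_iter_ext derive1_horner in lam; split=> //.
  by rewrite [iter i.+1 _ a]iterS -/b -iterSr iterS fixa.
rewrite horner_comp_iter_ext derive1_horner iterS -/b.
case: k k0 fixa lam {H} => // k _ fixb.
rewrite {1}comp_iterSr deriv_comp hornerM horner_comp mulrC.
rewrite [comp_iter q k.+1]/(q \Po comp_iter q k) deriv_comp hornerM horner_comp.
by rewrite horner_comp_iter -iterSr fixb.
Qed.

(** The difference quotient at [a] has the multiplier as its value there; [lam] is the midpoint
    between its modulus and 1. *)
Lemma attracting_contraction q k a : attracting_periodic q k a ->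
  exists lam d : R, [/\ 0 <= lam, lam < 1, 0 < d & forall x, normc (x - a) < d ->
    normc (iter k (horner q) x - a) <= lam * normc (x - a)].
Proof.
case=> k0 fixa; rewrite horner_comp_iter_ext derive1_horner => lam.
set p := comp_iter q k in lam *.
have pa : p.[a] = a by rewrite horner_comp_iter.
have [h hE Ep] := difference_quotient p a; rewrite Ep in lam.
have e0 : 0 < (1 - normc h.[a]) / 2 by lra.
have [d d0 Hd] := horner_cont h a e0.
exists ((1 + normc h.[a]) / 2), d; split=> //; [|lra|].
  by have := normc_ge0 h.[a]; lra.
move=> x /Hd xd; rewrite -{1}pa hE Normc.normcM ler_wpM2r ?normc_ge0//.
by have := normc_lipschitz h.[x] h.[a]; lra.
Qed.

(* A limit cycle of an orbit in the unit disc lies in the closed disc, hence in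
   the open one, so a small disc about one of its points is a trap. *)
Lemma attracted_approached q k a z :
  (forall k a, attracting_periodic q k a -> normc a <> 1) ->
  attracting_periodic q k a -> K_ q z ->
  (forall e : R, 0 < e -> \forall m \near \oo,
     exists i, normc (iter m (horner q) z - iter i (horner q) a) < e) ->
  approached q z.
Proof.
move=> circ att Kz conv.
have [k0 fixa _] := att.
have per i : iter (i * k) (horner q) a = a.
  by elim: i => // i IH; rewrite mulSn iterD IH.
(* By pigeonhole some point of the cycle is approached infinitely often: otherwise all [k] of them
   would be at distance at least some [e] from the late orbit. *)
have [i0 Hi0] : exists i0, forall e : R, 0 < e -> forall M, exists2 m, (M <= m)%N &
    normc (iter m (horner q) z - iter i0 (horner q) a) < e.
  apply: contrapT => /forallNP noi.
  have {}noi i : exists2 e : R, 0 < e & \forall m \near \oo,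
      e <= normc (iter m (horner q) z - iter i (horner q) a).
    have /existsNP[e /not_implyP[e0 /existsNP[M HM]]] := noi i.
    exists e => //; exists M => // m /= Mm; rewrite leNgt; apply/negP => lt.
    by apply: HM; exists m.
  have [e e0 He] : exists2 e : R, 0 < e & \forall m \near \oo, forall i, (i < k)%N ->
      e <= normc (iter m (horner q) z - iter i (horner q) a).
    elim: (k) => [|j [e e0 He]]; first by exists 1 => //; exact: nearW.
    have [e' e'0 He'] := noi j; exists (Num.min e e'); first by rewrite lt_min e0.
    near=> m => i; rewrite ltnS leq_eqVlt ge_min => /predU1P[->|ij].
      by apply/orP; right; near: m.
    by apply/orP; left; move: i ij; near: m.
  have : \forall m \near \oo, False.
    near=> m.
    have [l] : exists l, normc (iter m (horner q) z - iter l (horner q) a) < e.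
      by near: m; exact: conv.
    rewrite {1}(divn_eq l k) addnC iterD per; apply/negP; rewrite -leNgt.
    have : (l %% k < k)%N by rewrite ltn_mod.
    by move: (l %% k)%N; near: m.
  by case=> N _ /(_ N) /=; apply.
set b := iter i0 _ a in Hi0.
have attb : attracting_periodic q k b by exact: attracting_periodic_iter.
(* By continuity the orbit of [b] is a limit of points of the orbit of [z], hence in the closed
   disc; [circ] excludes the circle. *)
have bl l : normc (iter l (horner q) b) < 1.
  have ne1 := circ _ _ (attracting_periodic_iter l attb).
  rewrite lt_neqAle; apply/andP; split; first exact/eqP.
  apply/ler_addgt0Pr => e e0; rewrite horner_comp_iter_ext.
  have [d d0 Hd] := horner_cont (comp_iter q l) b e0.
  have [m _ /Hd] := Hi0 d d0 0%N; rewrite horner_comp_iter -iterD.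
  have := Kz (l + m)%N.
  have := normc_lipschitz (comp_iter q l).[b] (iter (l + m) (horner q) z).
  by rewrite (distcC (comp_iter q l).[b]); lra.
have [lam [d [lam0 lam1 d0 Hd]]] := attracting_contraction attb.
have [rho [d' [r0 r1 d'0 Hd']]] := @near_orbit_bound _ q b k (fun l _ => bl l).
pose r := Num.min d d' / 2.
have r_gt0 : 0 < r by rewrite divr_gt0 // lt_min d0.
have rd : r < d by rewrite /r; have := ge_min d d d'; rewrite lexx/= => ?; lra.
have rd' : r < d' by rewrite /r; have := ge_min d' d d'; rewrite lexx orbT => ?; lra.
have [j _ jb] := Hi0 r r_gt0 0%N.
apply: (@trap_approached _ q z b j k r (lam * r) rho) => //.
- by rewrite gtr_pMl.
- by move=> l x lk xb; apply: Hd' => //; exact: le_lt_trans xb rd'.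
- move=> x xb; apply: le_trans (Hd _ (le_lt_trans xb rd)) _.
  by rewrite ler_wpM2l.
Unshelve. all: by end_near. Qed.

End AttractingCycles.

(** * Montel's theorem and the Fatou set *)

Section Normality.
Variable R : realType.
Local Notation C := R[i].
Implicit Types (p q : {poly C}) (x y z w c a : C).

Lemma compact_closed_bounded (A : set C) (M : R) : closed A ->
  (forall x, A x -> normc x <= M) -> compact A.
Proof. by move=> cA AM; exact: subclosed_compact cA (@compact_normc_ball R M) AM. Qed.

Lemma closed_normc_preimage (f : C -> C) (r : R) : continuous f ->
  closed [set x | normc (f x) <= r].
Proof.
move=> fc; apply: (closed_comp (f := @normc R \o f) (D := [set t : R | t <= r])).
  by move=> x _; apply: continuous_comp; [exact: fc|exact: normc_continuous].
exact: closed_le.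
Qed.

Lemma compact_normc_disc z (r : R) : compact [set x | normc (x - z) <= r].
Proof.
apply: (@compact_closed_bounded _ (normc z + r)).
  rewrite (_ : [set x | _] = [set x | normc ('X - z%:P).[x] <= r]).
    exact/closed_normc_preimage/horner_continuous.
  by apply/seteqP; split=> x /=; rewrite hornerXsubC.
by move=> x /= xz; have := normc_lipschitz x z; lra.
Qed.

(* A pointwise cluster point exists by Tychonoff; the common Lipschitz constant
   makes the convergence along the corresponding filter uniform. *)
Lemma equilipschitz_subsequence (u : nat -> C -> C) z (r L M : R) : 0 < r -> 0 <= L ->
  (forall j x, normc (x - z) < 2 * r -> normc (u j x) <= M) ->
  (forall j x y, normc (x - z) < 2 * r -> normc (y - z) < 2 * r ->
    normc (u j x - u j y) <= L * normc (x - y)) ->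
  exists (phi : nat -> nat) (g : C -> C), {homo phi : i j / (i < j)%N} /\
    forall e : R, 0 < e -> \forall j \near \oo, forall x, normc (x - z) <= r ->
      normc (u (phi j) x - g x) < e.
Proof.
move=> r0 L0 uM uL.
have M0 : 0 <= M.
  by apply: le_trans (uM 0%N z _); rewrite ?normc_ge0// subrr normc_zero mulr_gt0.
(* Extension by 0 outside the disc makes every function bounded by [M] everywhere, so that all lie
   in a product of compact discs. *)
pose v j : prod_topology (fun=> C) := fun x => if normc (x - z) < 2 * r then u j x else 0.
have vu j x : normc (x - z) < 2 * r -> v j x = u j x by rewrite /v => ->.
have vM : (v @ \oo) [set f | forall x, normc (f x) <= M].
  exists 0%N => // j _ x /=; rewrite /v; case: ifP => [xz|_]; first exact: uM.
  by rewrite normc_zero.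
have [g [_]] := @tychonoff C (fun=> C) (fun=> [set x | normc x <= M])
  (fun=> @compact_normc_ball R M) (v @ \oo) _ vM.
rewrite cluster_cvgE => -[G GF [Gg vG]].
have Gpt x (e : R) : 0 < e -> \forall h \near G, normc (h x - g x) < e.
  move=> e0; apply: Gg.
  apply: (@proj_continuous _ (fun=> C) x g [set y | normc (y - g x) < e]).
  by apply/nbhs_normcP; exists e.
have GL : \forall h \near G, forall x y, normc (x - z) < 2 * r ->
    normc (y - z) < 2 * r -> normc (h x - h y) <= L * normc (x - y).
  apply: vG; exists 0%N => // j _ x y xz yz; rewrite !vu//; exact: uL.
have gL x y : normc (x - z) < 2 * r -> normc (y - z) < 2 * r ->
    normc (g x - g y) <= L * normc (x - y).
  move=> xz yz; apply/ler_addgt0Pr => e e0; have e2 : 0 < e / 2 by lra.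
  have [h [[hx hy] hL]] := filter_ex (filterI (filterI (Gpt x _ e2) (Gpt y _ e2)) GL).
  have := hL _ _ xz yz; have := distc_triangle (h x) (g x) (g y).
  by have := distc_triangle (h y) (h x) (g y); rewrite (distcC (g x) (h x)); lra.
have Gunif (e : R) : 0 < e ->
    \forall h \near G, [set x | normc (x - z) <= r] `<=` (fun x => normc (h x - g x) < e).
  move=> e0; have /compact_near_coveringP := @compact_normc_disc z r; apply => x /= xr.
  have e2 : 0 < e / 2 by lra.
  pose d := Num.min r (e / (4 * (L + 1))).
  have L1 : 0 < 4 * (L + 1) by lra.
  have d0 : 0 < d by rewrite lt_min r0 divr_gt0.
  have dr : d <= r by rewrite ge_min lexx.
  have dL : d * (4 * (L + 1)) <= e by rewrite -ler_pdivlMr// ge_min lexx orbT.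
  exists ([set y | normc (y - x) < d],
      [set h | normc (h x - g x) < e / 2 /\ forall x y, normc (x - z) < 2 * r ->
       normc (y - z) < 2 * r -> normc (h x - h y) <= L * normc (x - y)]) => /=.
    by split; [apply/nbhs_normcP; exists d|exact: filterI (Gpt x _ e2) GL].
  move=> [y h] /= [yx [hx hL]].
  have xz : normc (x - z) < 2 * r by lra.
  have yz : normc (y - z) < 2 * r by have := distc_triangle x y z; lra.
  have := hL _ _ yz xz; have := gL _ _ xz yz; rewrite (distcC x y).
  have := distc_triangle (h x) (h y) (g y); have := distc_triangle (g x) (h x) (g y).
  by have := normc_ge0 (y - x); nra.
have step (m J : nat) : exists j, (J <= j)%N /\
    forall x, normc (x - z) <= r -> normc (u j x - g x) < m.+1%:R^-1.
  have GJ : G (v @` [set j | (J <= j)%N]).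
    by apply: vG; exists J => // j /= Jj; exists j.
  have m0 : 0 < m.+1%:R^-1 :> R by rewrite invr_gt0.
  have [h [[j Jj <-] H]] := filter_ex (filterI GJ (Gunif _ m0)).
  exists j; split=> // x xz; rewrite -vu; first exact: H.
  by lra.
have {step} [c Hc] : exists c : nat -> nat -> nat, forall m J, (J <= c m J)%N /\
    forall x, normc (x - z) <= r -> normc (u (c m J) x - g x) < m.+1%:R^-1.
  have [c Hc] := choice (fun mJ : nat * nat => step mJ.1 mJ.2).
  by exists (fun m J => c (m, J)) => m J; exact: (Hc (m, J)).
pose fix phi m := if m is m'.+1 then c m (phi m').+1 else c 0%N 0%N.
exists phi, g; split.
  apply: homo_ltn => [? ? ?|i]; first exact: ltn_trans.
  by have [] := Hc i.+1 (phi i).+1.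
have Hphi m x : normc (x - z) <= r -> normc (u (phi m) x - g x) < m.+1%:R^-1.
  by case: m => [|m]; [have [_] := Hc 0%N 0%N|have [_] := Hc m.+1 (phi m).+1]; apply.
move=> e e0; near=> j => x /(Hphi j) /lt_trans; apply.
by near: j; exact: near_infty_natSinv_lt (PosNum e0).
Unshelve. all: by end_near. Qed.

Lemma iter_sphere_map q k x :
  iter k (sphere_map q) (Some x) = Some (iter k (horner q) x).
Proof. by elim: k => // k IH; rewrite !iterS IH. Qed.

Lemma chordal_dist_le x y :
  chordal_dist (Some x : one_point_compactification C) (Some y) <= 2 * normc (x - y).
Proof.
have H (t : C) : 1 <= Num.sqrt (1 + normc t ^+ 2).
  by rewrite -[X in X <= _]sqrtr1 ler_wsqrtr// lerDl sqr_ge0.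
rewrite /chordal_dist ler_pdivrMr; last first.
  by rewrite mulr_gt0// (lt_le_trans ltr01).
rewrite ler_peMr ?mulr_ge0 ?normc_ge0//.
by have := H x; have := H y; nra.
Qed.

Lemma interior_K_fatou q z (r : R) : 0 < r ->
  (forall x, normc (x - z) < r -> K_ q x) -> fatou_set (sphere_map q) (Some z).
Proof.
(* All iterates are bounded by 1 within [r], so [bounded_lipschitz] gives a common Lipschitz
   constant within [r / 8 = 2 * rho], the radius that [equilipschitz_subsequence] asks for. *)
move=> r0 Kr; pose rho := r / 16.
have rho0 : 0 < rho by rewrite divr_gt0.
pose B := [set x : C | normc (x - z) < rho].
have oB : open B.
  rewrite openE => x /= xB; apply/nbhs_normcP.
  exists (rho - normc (x - z)); first by rewrite subr_gt0.
  by move=> y yx; rewrite /B/=; have := distc_triangle x y z; lra.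
have oU : @open (one_point_compactification C) (Some @` B).
  exact: one_point_compactification_open_some.
exists (Some @` B); split=> //.
  by exists z => //; rewrite /B/= subrr normc_zero.
move=> s Fs; have /choice[k Hk] : forall j, exists k, iter k (sphere_map q) = s j.
  by move=> j; have [k _ <-] := Fs j; exists k.
pose u j := iter (k j) (horner q).
have ru : 2 * rho = r / 8 by rewrite /rho; field.
have [|||phi [g [phiH conv]]] := @equilipschitz_subsequence u z rho (8 * 1 / r) 1 rho0.
- by rewrite divr_ge0// ?ltW// mulr1.
- by move=> j x; rewrite ru => xr; apply/ltW/Kr; lra.
- move=> j x y; rewrite ru => xr yr; rewrite /u -!horner_comp_iter.
  apply: (bounded_lipschitz r0 _ xr yr) => t tr.
  by rewrite horner_comp_iter; apply/ltW/Kr.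
exists phi, (fun t => if t is Some x then Some (g x) else None); split=> //.
move=> _ [x xB <-]; exists (Some @` B).
  by apply: open_nbhs_nbhs; split=> //; exists x.
move=> e e0; have e2 : 0 < e / 2 by lra.
apply: filterS (conv _ e2) => j H _ [y yB <-].
rewrite -Hk iter_sphere_map; apply: le_lt_trans (chordal_dist_le _ _) _.
have := H y (ltW yB); rewrite /u; lra.
Qed.

End Normality.

(** * Comparison of the filled Julia sets with the limit set *)

Section LimitOfFilledJuliaSets.
Variable R : realType.
Local Notation C := R[i].
Implicit Types (q : {poly C}) (x y z w a b : C).

(** Turns chordal convergence into convergence in the plane: on bounded sets the denominator of the
    chordal distance is bounded. *)
Lemma chordal_dist_ge x y (M : R) : normc x <= 1 -> normc y <= M ->
  normc (x - y) <=
    (1 + M) * chordal_dist (Some x : one_point_compactification C) (Some y).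
Proof.
move=> x1 yM; rewrite /chordal_dist.
have H (t : C) : 0 < Num.sqrt (1 + normc t ^+ 2) <= 1 + normc t.
  rewrite sqrtr_gt0 ltr_pwDl ?exprn_ge0 ?normc_ge0//=.
  rewrite -[X in _ <= X]ger0_norm ?addr_ge0 ?normc_ge0// -sqrtr_sqr ler_wsqrtr//.
  by have := normc_ge0 t; nra.
have /andP[sx0 sx] := H x; have /andP[sy0 sy] := H y.
rewrite mulrA ler_pdivlMr ?mulr_gt0//.
have uv : Num.sqrt (1 + normc x ^+ 2) * Num.sqrt (1 + normc y ^+ 2) <= 2 * (1 + M).
  by apply: ler_pM; [exact: ltW|exact: ltW|lra|lra].
have := ler_wpM2l (normc_ge0 (x - y)) uv; lra.
Qed.

Lemma fatou_K_approached q z : (2 < size q)%N -> hyperbolic q ->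
  (forall k a, attracting_periodic q k a -> normc a <> 1) ->
  K_ q z -> fatou_set (sphere_map q) (Some z) -> approached q z.
Proof.
move=> q2 hyp circ Kz /hyp[A [[[k [a [att ->]]]|[_ ->]] conv]]; last first.
  (* Convergence to infinity is impossible: a point of the unit disc has chordal distance at least 1
     from infinity. *)
  have [N _ /(_ N (leqnn _))[_ ->]] := conv 1 ltr01.
  rewrite iter_sphere_map /chordal_dist; have := Kz N.
  set w := iter N _ z => w1; rewrite ltr_pdivrMr ?mul1r; last first.
    by rewrite sqrtr_gt0 ltr_pwDl// exprn_ge0// normc_ge0.
  rewrite ltNge => /negP[]; rewrite -[X in _ <= X]ger0_norm// -sqrtr_sqr ler_wsqrtr//.
  by have := normc_ge0 w; nra.
apply: (attracted_approached circ att Kz) => e e0.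
pose M := \big[Num.max/0]_(i < k) normc (iter i (horner q) a).
have aM i : normc (iter i (horner q) a) <= M.
  have [k0 fixa _] := att.
  have per l : iter (l * k) (horner q) a = a.
    by elim: l => // l IH; rewrite mulSn iterD IH.
  rewrite (divn_eq i k) addnC iterD per.
  have ik : (i %% k < k)%N by rewrite ltn_mod.
  exact: (le_bigmax _ (fun i : 'I_k => normc (iter i (horner q) a)) (Ordinal ik)).
have M0 : 0 <= M := le_trans (normc_ge0 _) (aM 0%N).
have e1 : 0 < e / (1 + M) by rewrite divr_gt0//; lra.
apply: filterS (conv _ e1) => m [_ [i _ <-]].
rewrite iter_sphere_map => H; exists i.
apply: le_lt_trans (chordal_dist_ge (ltW (Kz m)) (aM i)) _.
by rewrite mulrC -ltr_pdivlMr//; lra.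
Qed.

Lemma exit_time q x : ~ K_ q x -> exists j, 1 <= normc (iter j (horner q) x) /\
  forall l, (l < j)%N -> normc (iter l (horner q) x) < 1.
Proof.
move=> nK; have exj : exists j, 1 <= normc (iter j (horner q) x).
  by move/existsNP: nK => [j /negP]; rewrite -leNgt; exists j.
case: (ex_minnP exj) => j xj minj; exists j; split=> // l lj.
by rewrite ltNge; apply/negP => /minj; rewrite leqNgt lj.
Qed.

(** Let [j] be the least time at which some point of the segment from [z] to [w] is outside the open
    disc. The intermediate value theorem puts a point on the circle at time [j], and minimality over
    the whole segment keeps its earlier iterates inside. *)
Lemma segment_S q z w : K_ q z -> ~ K_ q w ->
  exists j s, S_ q j s /\ normc (s - z) <= normc (w - z).
Proof.
move=> Kz nKw; pose g (t : R) : C := z + t%:C * (w - z).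
pose exits j := exists2 t : R, 0 <= t <= 1 & 1 <= normc (iter j (horner q) (g t)).
have exj : exists j, `[< exits j >].
  have [j [wj _]] := exit_time nKw; exists j; apply/asboolP.
  exists 1; first by rewrite lexx ler01.
  by rewrite /g mul1r subrKC.
case: (ex_minnP exj) => j /asboolP[t /andP[t0 t1] gt1] minj.
pose h (t : R) : R := normc (iter j (horner q) (g t)).
have gc : continuous g.
  move=> u U /nbhs_normcP[e e0 He].
  have d0 : 0 < e / (1 + normc (w - z)).
    by rewrite divr_gt0// ltr_pwDl// normc_ge0.
  exists (e / (1 + normc (w - z))) => //= v.
  rewrite /ball_/= ltr_pdivlMr ?ltr_pwDl ?normc_ge0// => uv.
  apply: He; rewrite /g opprD addrACA subrr add0r -mulrBl -rmorphB.
  rewrite Normc.normcM normc_real.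
  by rewrite distrC; apply: le_lt_trans uv; rewrite ler_wpM2l// lerDr.
have hc : continuous h.
  move=> u.
  apply: (@continuous_comp _ _ _ g (fun x => normc (iter j (horner q) x))).
    exact: gc.
  by apply: continuous_comp; [exact: iter_horner_continuous|exact: normc_continuous].
have h0 : h 0 < 1 by rewrite /h /g mul0r addr0; exact: Kz.
have [||u] := @IVT R h 0 t 1 t0.
- exact: continuous_subspaceT.
- by rewrite ge_min le_max (ltW h0) [1 <= h t]gt1 orbT.
rewrite in_itv/= => /andP[u0 ut] hu1; exists j, (g u); split; [split=> // l lj|].
  rewrite ltNge; apply/negP => gl.
  have /minj : `[< exits l >].
    by apply/asboolP; exists u => //; rewrite u0 (le_trans ut).
  by rewrite leqNgt lj.
rewrite /g addrAC subrr add0r Normc.normcM normc_real ger0_norm//.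
by rewrite ler_piMl ?normc_ge0// (le_trans ut).
Qed.

Lemma K_infty_approached q z : (2 < size q)%N -> hyperbolic q ->
  (forall k a, attracting_periodic q k a -> normc a <> 1) ->
  K_infty q z -> approached q z.
Proof.
move=> q2 hyp circ [Kz|[j _ Sz]]; last exact: S_approached Sz.
have [[r r0 Kr]|noint] := pselect (exists2 r : R, 0 < r &
    forall x, normc (x - z) < r -> K_ q x).
  by apply: fatou_K_approached => //; exact: interior_K_fatou Kr.
apply: approached_closed => e e0.
have [w wz nKw] : exists2 w, normc (w - z) < e & ~ K_ q w.
  apply: contrapT => H; apply: noint; exists e => // x xz.
  by apply: contrapT => nKx; apply: H; exists x.
have [j [s [Ss sz]]] := segment_S Kz nKw.
exists s; first exact: S_approached Ss.
exact: le_lt_trans wz.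
Qed.

(** The first iterate outside the open disc is strictly outside the closed one, since otherwise [x]
    is in [S_ q j]; this persists nearby. It serves both for the closedness of [K_infty q] and for
    the exit under ['X^n + q]. *)
Lemma K_infty_exit q x : ~ K_infty q x -> exists (j : nat) (rho d eta : R),
  [/\ 0 <= rho, rho < 1, 0 < d, 0 < eta & forall y, normc (y - x) < d ->
    1 + eta + eta <= normc (iter j (horner q) y) /\
    forall l, (l < j)%N -> normc (iter l (horner q) y) <= rho].
Proof.
move=> nK; have [|j [xj xl]] := @exit_time q x; first by move=> Kx; apply: nK; left.
have xj1 : 1 < normc (iter j (horner q) x).
  rewrite lt_neqAle xj andbT eq_sym; apply/eqP => xj1.
  by apply: nK; right; exists j.
have [rho [d [r0 r1 d0 Hd]]] := near_orbit_bound xl.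
(* One third of the excess is for moving from [x] to [y], one for the perturbation of the iterate,
   one for the bound [1 + eta] on the filled Julia sets. *)
pose eta := (normc (iter j (horner q) x) - 1) / 3.
have eta0 : 0 < eta by rewrite /eta; lra.
have [d' d'0 Hd'] := horner_cont (comp_iter q j) x eta0.
exists j, rho, (Num.min d d'), eta; split=> //; first by rewrite lt_min d0.
move=> y; rewrite lt_min => /andP[yd yd']; split; last exact: Hd.
have := Hd' y yd'; rewrite !horner_comp_iter distcC.
have := normc_lipschitz (iter j (horner q) x) (iter j (horner q) y).
by rewrite /eta; lra.
Qed.

Lemma exit_filled_julia q x : ~ K_infty q x ->
  \forall x' \near x & n \near \oo, ~ filled_julia (horner ('X^n + q)) x'.
Proof.
move=> /K_infty_exit[j [rho [d [eta [r0 r1 d0 eta0 Hd]]]]].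
have bound := filled_julia_bound q eta0.
have conv := @perturbed_iter_cvg _ q [set y | normc (y - x) < d] rho j r0 r1 _ _ eta0.
exists ([set y | normc (y - x) < d], [set n |
    (forall z, filled_julia (horner ('X^n + q)) z -> normc z < 1 + eta) /\
    forall y, normc (y - x) < d ->
      normc (iter j (horner ('X^n + q)) y - iter j (horner q) y) <= eta]) => /=.
  split; first by apply/nbhs_normcP; exists d.
  apply: filterI => //; apply: conv => l y lj /= /Hd[_]; exact.
move=> [y n] /= [yx [bnd cnv]] /(@filled_julia_iter _ _ y j)/bnd.
have [yj _] := Hd _ yx; have := cnv _ yx; rewrite distcC.
have := normc_lipschitz (iter j (horner q) y) (iter j (horner ('X^n + q)) y).
lra.
Qed.

Lemma K_infty_normc q x : K_infty q x -> normc x <= 1.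
Proof.
case=> [Kx|[[|j] _ [x1 xl]]]; first exact/ltW/(Kx 0%N).
  by rewrite -x1.
exact/ltW/(xl 0%N).
Qed.

Lemma compact_K_infty q : compact (K_infty q).
Proof.
apply: (compact_closed_bounded (M := 1)); last exact: K_infty_normc.
rewrite -[K_infty q]setCK; apply: open_closedC; rewrite openE => x /K_infty_exit.
move=> [j [rho [d [eta [r0 r1 d0 eta0 Hd]]]]]; apply/nbhs_normcP; exists d => // y yx.
have [yj yl] := Hd _ yx; case=> [Ky|[i _ [yi Hi]]]; first by have := Ky j; lra.
case: (ltngtP i j) => [ij|ji|ij].
- by have := yl _ ij; rewrite yi; lra.
- by have := Hi _ ji; lra.
- by move: yj; rewrite -ij yi; lra.
Qed.

Lemma compact_filled_julia q :
  \forall n \near \oo, compact (filled_julia (horner ('X^n + q))).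
Proof.
apply: filterS (filled_julia_bound q ltr01) => n bnd.
apply: (compact_closed_bounded (M := 1 + 1)); last by move=> x /bnd/ltW.
(* The common escape radius 2 turns boundedness of the orbit into an intersection of closed
   conditions. *)
rewrite (_ : filled_julia _ = \bigcap_(k in [set: nat])
    [set x | normc (iter k (horner ('X^n + q)) x) <= 1 + 1]).
  by apply: closed_bigI => k _; exact/closed_normc_preimage/iter_horner_continuous.
apply/seteqP; split => x /=.
  by move=> Kx k _ /=; exact/ltW/bnd/filled_julia_iter.
by move=> H; exists (1 + 1) => k; exact: H.
Qed.

(** * Estimates in the Hausdorff distance *)

Lemma dist_to_le (B : set C) a b (e : R) : B b -> normc (a - b) <= e ->
  (dist_to B a <= e%:E)%E.
Proof.
move=> Bb ab; apply: ge_ereal_inf; exists (normc (a - b))%:E; last by rewrite lee_fin.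
by exists b.
Qed.

Lemma dist_to_ge0 (B : set C) a : (0 <= dist_to B a)%E.
Proof.
by apply: le_ereal_inf_tmp => _ [b _ <-]; rewrite lee_fin normc_ge0.
Qed.

Lemma hausdorff_dist_le (A B : set C) (e : R) :
  (forall a, A a -> exists2 b, B b & normc (a - b) <= e) ->
  (forall b, B b -> exists2 a, A a & normc (b - a) <= e) ->
  (hausdorff_dist A B <= e%:E)%E.
Proof.
move=> AB BA; rewrite /hausdorff_dist ge_max; apply/andP; split.
  by apply: ge_ereal_sup => _ [a /AB[b Bb ab] <-]; exact: dist_to_le ab.
by apply: ge_ereal_sup => _ [b /BA[a Aa ab] <-]; exact: dist_to_le ab.
Qed.

(** A supremum over the empty set is [-oo]; the point [b] makes the second supremum non-negative. *)
Lemma hausdorff_dist_ge0 (A B : set C) b : B b -> (0 <= hausdorff_dist A B)%E.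
Proof.
move=> Bb; rewrite /hausdorff_dist le_max; apply/orP; right.
by apply: le_ereal_sup_tmp; exists (dist_to A b); [exists b|exact: dist_to_ge0].
Qed.

(** Compactness of the disc of radius 2 glues local statements: a point [x] of [K_infty q] serves as
    [b] for all points near it, and near any other [x] the filled Julia sets are eventually
    absent. *)
Lemma filled_julia_near_K_infty q (e : R) : 0 < e -> \forall n \near \oo,
  forall a, filled_julia (horner ('X^n + q)) a ->
    exists2 b, K_infty q b & normc (a - b) <= e.
Proof.
move=> e0; have bound := filled_julia_bound q ltr01.
have /compact_near_coveringP cov := @compact_normc_ball R 2.
have near_disc := cov nat \oo (fun n a => filled_julia (horner ('X^n + q)) a ->
  exists2 b, K_infty q b & normc (a - b) <= e) _ _.
have {}near_disc : \forall n \near \oo, [set z | normc z <= 2] `<=` (fun a =>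
    filled_julia (horner ('X^n + q)) a -> exists2 b, K_infty q b & normc (a - b) <= e).
  apply: near_disc => x _; have [Kx|nKx] := pselect (K_infty q x).
    exists ([set y | normc (y - x) < e], setT) => /=.
      by split; [apply/nbhs_normcP; exists e|exact: filterT].
    by move=> [y n] /= [yx _] _; exists x => //; exact: ltW.
  by apply: filterS (exit_filled_julia nKx) => -[y n] /= H /H.
near=> n => a Ka.
have cn : [set z | normc z <= 2] `<=` (fun a => filled_julia (horner ('X^n + q)) a ->
    exists2 b, K_infty q b & normc (a - b) <= e) by near: n.
apply: cn => //=; apply/ltW; rewrite (_ : 2 = 1 + 1)//.
by move: a Ka; near: n.
Unshelve. all: by end_near. Qed.

Lemma K_infty_near_filled_julia q (e : R) : (2 < size q)%N -> hyperbolic q ->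
  (forall k a, attracting_periodic q k a -> normc a <> 1) -> 0 < e ->
  \forall n \near \oo, forall b, K_infty q b ->
    exists2 a, filled_julia (horner ('X^n + q)) a & normc (b - a) <= e.
Proof.
move=> q2 hyp circ e0; have /compact_near_coveringP := @compact_K_infty q.
apply => x Kx; have e2 : 0 < e / 2 by lra.
exists ([set y | normc (y - x) < e / 2], [set n | exists2 a,
   filled_julia (horner ('X^n + q)) a & normc (a - x) < e / 2]) => /=.
  split; first by apply/nbhs_normcP; exists (e / 2).
  exact: (K_infty_approached q2 hyp circ Kx).
move=> [y n] /= [yx [a Ka ax]]; exists a => //.
by have := distc_triangle x y a; rewrite (distcC x a); lra.
Qed.

End LimitOfFilledJuliaSets.

Unset Implicit Arguments.

Theorem theorem1p6 (R : realType) (q : {poly R[i]})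
  (q_deg : (2 < size q)%N)
  (q_hyp : hyperbolic q)
  (q_circle : forall (k : nat) (z : R[i]),
      attracting_periodic q k z -> normc z <> 1) :
  hausdorff_cvg
    (fun n : nat => filled_julia (fun z : R[i] => z ^+ n + q.[z]))
    (K_infty q).
Proof.
have -> : (fun n : nat => filled_julia (fun z : R[i] => z ^+ n + q.[z])) =
    (fun n => filled_julia (horner ('X^n + q))).
  apply/funext => n; congr (filled_julia _); apply/funext => z.
  by rewrite hornerD hornerXn.
split; [exact: compact_K_infty|exact: compact_filled_julia|].
move=> U nU; have : nbhs (0 : R) (fun r => U r%:E) := nU.
move=> /nbhs_ballP[e /= e0 He]; have e2 : 0 < e / 2 by lra.
have near1 := filled_julia_near_K_infty q e2.
have near2 := K_infty_near_filled_julia q_deg q_hyp q_circle e2.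
apply: filterS2 near1 near2 => n H1 H2; rewrite /=.
have := hausdorff_dist_le H1 H2.
(* The point 1 lies in [S_ q 0], so the distance is non-negative; with the upper bound this leaves
   only a finite value. *)
have /(@hausdorff_dist_ge0 _ (filled_julia (horner ('X^n + q)))) : K_infty q 1.
  by right; exists 0%N => //; split=> //; exact: normc_one.
case: (hausdorff_dist _ _) => [r| |]//; rewrite !lee_fin => r0 re.
by apply: He; rewrite /ball/= sub0r normrN ger0_norm//; lra.
Qed.
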